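(* Let $\mathbf{P}\in\mathbb{R}^{S\times S}$ be positive definite. Given a realization of $(\delta_k,\mathbf{H}_k)$ with $\delta_k\in\{0,1\}$, $\mathbf{H}_k\in\mathbb{R}^{N_r\times N_t}$, the matrix $\mathbf{P}$ can be decomposed as $\mathbf{P}=\mathbf{P}_k^{c}+\mathbf{P}_k^{uc}$ with $\mathbf{P}_k^{c}\in\mathcal C^{c}$ and $\mathbf{P}_k^{uc}\in\mathcal C^{uc}$, where $$\mathbf{P}_k^{c}=\mathbf{V}_k^T\begin{bmatrix}(\mathbf{V}_k\mathbf{P}\mathbf{V}_k^T)_{\gamma_k}&(\mathbf{V}_k\mathbf{P}\mathbf{V}_k^T)_{\gamma_k}\boldsymbol\Sigma_k\\ \boldsymbol\Sigma_k^T(\mathbf{V}_k\mathbf{P}\mathbf{V}_k^T)_{\gamma_k}&\boldsymbol\Sigma_k^T(\mathbf{V}_k\mathbf{P}\mathbf{V}_k^T)_{\gamma_k}\boldsymbol\Sigma_k\end{bmatrix}\mathbf{V}_k,$$ $$\mathbf{P}_k^{uc}=\mathbf{V}_k^T(\mathbf{I}-\boldsymbol\Pi_k)\mathbf{V}_k\mathbf{P}\mathbf{V}_k^T(\mathbf{I}-\boldsymbol\Pi_k)\mathbf{V}_k-\mathbf{V}_k^T\,\mathrm{diag}\big(\mathbf{0}_{\gamma_k},\boldsymbol\Sigma_k^T(\mathbf{V}_k\mathbf{P}\mathbf{V}_k^T)_{\gamma_k}\boldsymbol\Sigma_k\big)\mathbf{V}_k,$$ and $\boldsymbol\Sigma_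k=(\mathbf{V}_k\mathbf{P}\mathbf{V}_k^T)_{\gamma_k}^{-1}(\mathbf{V}_k\mathbf{P}\mathbf{V}_k^T)_{1:\gamma_k;\gamma_k+1:S}$.
   Context: $\mathbf{B}\in\mathbb{R}^{S\times N_r}$, and $\mathbf{M}\in\mathbb{R}^{N_r\times N_r}$, $\mathbf{R}\in\mathbb{R}^{N_t\times N_t}$ are positive definite. Let $$\delta_k\mathbf{B}\mathbf{H}_k(\delta_k\mathbf{H}_k^T\mathbf{M}\mathbf{H}_k+\mathbf{R})^{-1}\mathbf{H}_k^T\mathbf{B}^T=\mathbf{V}_k^T\boldsymbol\Lambda_k\mathbf{V}_k$$ be the SVD with $\mathbf{V}_k\in\mathbb{R}^{S\times S}$ orthogonal and the diagonal entries of the diagonal matrix $\boldsymbol\Lambda_k$ in descending order; let $\gamma_k=\mathrm{rank}(\delta_k\mathbf{B}\mathbf{H}_k\mathbf{H}_k^T\mathbf{B}^T)$ and $\boldsymbol\Pi_k=\begin{bmatrix}\mathbf{I}_{\gamma_k}&\mathbf{0}\\ \mathbf{0}&\mathbf{0}\end{bmatrix}\in\mathbb{R}^{S\times S}$. For a matrix $\mathbf{X}$, $(\mathbf{X})_i$ is its $i$-th order leading principal submatrix and $(\mathbf{X})_{i:j;l:m}$ is the block of rows $i,\dots,j$ and columns $l,\dots,m$. $\mathbf{0}_{\gamma_k}$ is the $\gamma_k\times\gamma_k$ zero block. Let $\mathbb{S}^{S}$ denote the set of $S\times S$ positive semidefinite matrices. For a realization of $(\delta_k,\mathbf{H}_k)$,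 the controllable and uncontrollable PSD cones are $$\mathcal C^{c}=\{\mathbf{T}\in\mathbb{S}^{S}:\ker(\delta_k\mathbf{B}\mathbf{H}_k\mathbf{H}_k^T\mathbf{B}^T\mathbf{T})=\ker(\mathbf{T})\},\qquad \mathcal C^{uc}=\{\mathbf{T}\in\mathbb{S}^{S}:\delta_k\mathbf{B}\mathbf{H}_k\mathbf{H}_k^T\mathbf{B}^T\mathbf{T}=\mathbf{0}\}.$$ *)

(* Defs.v *)
From mathcomp Require Export all_boot all_order all_algebra.
From mathcomp Require Export boolp classical_sets reals.
From mathcomp Require Export sesquilinear.
Set Implicit Arguments.
Unset Strict Implicit.
Unset Printing Implicit Defensive.
Import Order.TTheory GRing.Theory Num.Theory.
Local Open Scope classical_set_scope.
Local Open Scope ring_scope.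

(* Definiteness includes symmetry. *)
Definition posdefmx (R : realType) (n : nat) (A : 'M[R]_n) : Prop :=
  A \is symmetricmx /\
  (forall x : 'cV[R]_n, x != 0 -> 0 < (x^T *m A *m x) 0 0).

Definition possemidefmx (R : realType) (n : nat) : set 'M[R]_n :=
  [set A | A \is symmetricmx /\
           (forall x : 'cV[R]_n, 0 <= (x^T *m A *m x) 0 0)].

(* Kernel of A acting on column vectors; the library's [kermx] is the kernel of
   the action on row vectors. *)
Definition colker (R : realType) (m n : nat) (A : 'M[R]_(m, n)) :
  set 'cV[R]_n := [set x | A *m x = 0].

(* A singular value decomposition G = V^T L V with the same orthogonal factor on
   both sides. *)
Definition symmetric_svd (R : realType) (n : nat) (G V L : 'M[R]_n) : Prop :=
  [/\ V *m V^T = 1%:M,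
      is_diag_mx L,
      (forall i, 0 <= L i i),
      (forall i j : 'I_n, (i <= j)%N -> L j j <= L i i)
    & G = V^T *m L *m V].

Definition control_mx (R : realType) (S Nr Nt : nat) (B : 'M[R]_(S, Nr))
    (delta : R) (H : 'M[R]_(Nr, Nt)) : 'M[R]_S :=
  delta *: (B *m H *m H^T *m B^T).

Definition gain_mx (R : realType) (S Nr Nt : nat) (B : 'M[R]_(S, Nr))
    (M : 'M[R]_Nr) (N : 'M[R]_Nt) (delta : R) (H : 'M[R]_(Nr, Nt)) : 'M[R]_S :=
  delta *: (B *m H *m invmx (delta *: (H^T *m M *m H) + N) *m H^T *m B^T).

Definition controllable_cone (R : realType) (n : nat) (K : 'M[R]_n) :
    set 'M[R]_n :=
  [set T | possemidefmx T /\ colker (K *m T) = colker T].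

Definition uncontrollable_cone (R : realType) (n : nat) (K : 'M[R]_n) :
    set 'M[R]_n :=
  [set T | possemidefmx T /\ K *m T = 0].

Definition rank_split (R : realType) (n : nat) (K : 'M[R]_n) :
  (\rank K + (n - \rank K) = n)%N := subnKC (rank_leq_row K).

(* A proof e : g + h = n splits the n indices into the first g and the last h;
   blocks of an n x n matrix are then taken, and assembled, through casts
   along e. *)
Section Blocks.
Context (R : realType) (g h n : nat) (e : (g + h = n)%N).

Definition leading_block (X : 'M[R]_n) : 'M[R]_g :=
  ulsubmx (castmx (esym e, esym e) X).

Definition upper_right_block (X : 'M[R]_n) : 'M[R]_(g, h) :=
  ursubmx (castmx (esym e, esym e) X).

Definition assemble (Xul : 'M[R]_g) (Xur : 'M[R]_(g, h))
    (Xdl : 'M[R]_(h, g)) (Xdr : 'M[R]_h) : 'M[R]_n :=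
  castmx (e, e) (block_mx Xul Xur Xdl Xdr).

Definition sigma_mx (V P : 'M[R]_n) : 'M[R]_(g, h) :=
  let W := V *m P *m V^T in
  invmx (leading_block W) *m upper_right_block W.

Definition controllable_part (V P : 'M[R]_n) : 'M[R]_n :=
  let A := leading_block (V *m P *m V^T) in
  let Sigma := sigma_mx V P in
  V^T *m assemble A               (A *m Sigma)
                  (Sigma^T *m A)  (Sigma^T *m A *m Sigma) *m V.

Definition uncontrollable_part (V P : 'M[R]_n) : 'M[R]_n :=
  let A := leading_block (V *m P *m V^T) in
  let Sigma := sigma_mx V P in
  let Pi : 'M[R]_n := pid_mx g in
  V^T *m (1%:M - Pi) *m V *m P *m V^T *m (1%:M - Pi) *m V
  - V^T *m assemble 0 0 0 (Sigma^T *m A *m Sigma) *m V.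

End Blocks.

(* Main.v *)
Require Import Defs.
Set Implicit Arguments.
Unset Strict Implicit.
Unset Printing Implicit Defensive.
Import Order.TTheory GRing.Theory Num.Theory.
Local Open Scope classical_set_scope.
Local Open Scope ring_scope.

(** Since [(delta H^T M H + N)^-1] is positive definite, the gain matrix and
    [K = delta B H H^T B^T] have the same kernel.  The diagonal of [Lambda] is
    sorted and nonnegative, so [K *m X = 0] means that the first [\rank K] rows
    of [V *m X] vanish.  In the coordinates given by [V], the decomposition is
    the block LDL^T splitting of [W = V P V^T]: with [A] its leading block,
    [P^c] corresponds to [[1 Sigma]^T A [1 Sigma]], and [P^uc] to the Schur
    complement of [A] in [W]. *)

(** * Definite and semidefinite matrices under inversion, congruence and sums *)

Section Definiteness.
Variable R : realType.

Lemma symmetricmxP n (A : 'M[R]_n) : A \is symmetricmx <-> A^T = A.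
Proof.
split; first by move/is_hermitianmxP; rewrite expr0 scale1r map_mx_id.
by move=> eA; apply/is_hermitianmxP; rewrite expr0 scale1r map_mx_id.
Qed.

Lemma posdefmx_possemidef n (A : 'M[R]_n) : posdefmx A -> possemidefmx A.
Proof.
move=> [symA posA]; split=> // x; have [->|/posA/ltW//] := eqVneq x 0.
by rewrite mulmx0 mxE.
Qed.

(** Each column [x] of [X] contributes [x^T *m A *m x] as a diagonal entry of the product, and this
    would be positive if [x] were nonzero. *)
Lemma posdefmx_form_eq0 n m (A : 'M[R]_n) (X : 'M[R]_(n, m)) :
  posdefmx A -> X^T *m A *m X = 0 -> X = 0.
Proof.
move=> [_ posA] XAX0; apply/matrixP=> i j.
have [cX0|/posA] := eqVneq (col j X) 0.
  by move/matrixP: cX0 => /(_ i 0); rewrite !mxE.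
rewrite colE trmx_mul -!mulmxA (mulmxA A) (mulmxA X^T) (mulmxA X^T) XAX0.
by rewrite mul0mx mulmx0 mxE ltxx.
Qed.

Lemma posdefmx_unit n (A : 'M[R]_n) : posdefmx A -> A \in unitmx.
Proof.
(* The columns of [cokermx A] are annihilated by [A], so definiteness forces them to vanish. *)
move=> posA; rewrite -row_full_unit -cokermx_eq0; apply/eqP.
by apply: (posdefmx_form_eq0 posA); rewrite -mulmxA mulmx_coker mulmx0.
Qed.

Lemma posdefmx1 n : posdefmx (1%:M : 'M[R]_n).
Proof.
split=> [|x x_neq0]; first by apply/symmetricmxP; rewrite trmx1.
have xx_ge0 i : true -> 0 <= x^T 0 i * x i 0.
  by move=> _; rewrite mxE -expr2 sqr_ge0.
rewrite mulmx1 mxE lt_def sumr_ge0 // andbT.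
apply: contra x_neq0 => /eqP/psumr_eq0P x0; apply/eqP/matrixP=> i j.
have /eqP := x0 xx_ge0 i isT.
by rewrite ord1 !mxE mulf_eq0 orbb => /eqP.
Qed.

Lemma posdefmx_inv n (A : 'M[R]_n) : posdefmx A -> posdefmx (invmx A).
Proof.
move=> posA; have uA := posdefmx_unit posA.
have [/symmetricmxP symA pos_form] := posA.
have symV : (invmx A)^T = invmx A by rewrite trmx_inv symA.
split=> [|x x_neq0]; first exact/symmetricmxP.
have -> : x^T *m invmx A *m x = (invmx A *m x)^T *m A *m (invmx A *m x).
  by rewrite trmx_mul symV mulmxA mulmxKV.
apply: pos_form; apply: contra x_neq0 => /eqP Ax0.
by rewrite -(mulKVmx uA x) Ax0 mulmx0.
Qed.

Lemma possemidefmx_congr n m (A : 'M[R]_n) (F : 'M[R]_(n, m)) :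
  possemidefmx A -> possemidefmx (F^T *m A *m F).
Proof.
move=> [/symmetricmxP symA psdA]; split=> [|x].
  by apply/symmetricmxP; rewrite !trmx_mul trmxK symA mulmxA.
by have := psdA (F *m x); rewrite trmx_mul !mulmxA.
Qed.

Lemma posdefmx_congr n m (A : 'M[R]_n) (F : 'M[R]_(n, m)) :
  (forall x : 'cV_m, F *m x = 0 -> x = 0) ->
  posdefmx A -> posdefmx (F^T *m A *m F).
Proof.
move=> injF posA; have [symFAF _] := possemidefmx_congr F (posdefmx_possemidef posA).
split=> // x x_neq0; case: posA => _ posA.
have /posA : F *m x != 0 by apply: contra x_neq0 => /eqP/injF ->.
by rewrite trmx_mul !mulmxA.
Qed.

Lemma posdefmxD n (A C : 'M[R]_n) :
  possemidefmx A -> posdefmx C -> posdefmx (A + C).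
Proof.
move=> [/symmetricmxP symA psdA] [/symmetricmxP symC posC]; split=> [|x x0].
  by apply/symmetricmxP; rewrite linearD /= symA symC.
by rewrite mulmxDr mulmxDl mxE ltr_wpDl // posC.
Qed.

End Definiteness.

(** * Comparison of the kernels of the control, gain and diagonal matrices *)

Section Kernels.
Variable R : realType.

(** Multiplying by [X^T] on the left produces the form of [Q] at [C^T *m X]. The right-hand side is
    free of [Q], so two definite weights give the same kernel. *)
Lemma gram_mul_eq0 n m p (C : 'M[R]_(n, m)) (Q : 'M[R]_m) (X : 'M[R]_(n, p)) :
  posdefmx Q -> (C *m Q *m C^T *m X = 0) <-> (C^T *m X = 0).
Proof.
move=> posQ; split=> [CQ0|CX0]; last by rewrite -mulmxA CX0 mulmx0.
apply: (posdefmx_form_eq0 posQ).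
by rewrite trmx_mul trmxK !mulmxA -!(mulmxA X^T) CQ0 mulmx0.
Qed.

(** Up to the factor [delta], both matrices are Gram matrices of [B *m H], with the identity and the
    inverse as definite weights. *)
Lemma control_gain_ker (S Nr Nt : nat) (B : 'M[R]_(S, Nr)) (M : 'M[R]_Nr)
    (N : 'M[R]_Nt) (delta : R) (H : 'M[R]_(Nr, Nt)) m (X : 'M[R]_(S, m)) :
  posdefmx M -> posdefmx N -> 0 <= delta ->
  (control_mx B delta H *m X = 0) <-> (gain_mx B M N delta H *m X = 0).
Proof.
move=> posM posN delta_ge0; rewrite /control_mx /gain_mx.
have [->|delta_neq0] := eqVneq delta 0; first by rewrite !scale0r mul0mx.
have scale_eq0 (Y : 'M[R]_(S, m)) : delta *: Y = 0 <-> Y = 0.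
  split=> [/eqP|->]; last by rewrite scaler0.
  by rewrite scaler_eq0 (negPf delta_neq0) => /eqP.
rewrite -!scalemxAl !scale_eq0.
(* Since [delta] is nonnegative, [delta *: (H^T *m M *m H)] is semidefinite; adding [N] makes it
   definite. *)
set Q := invmx _; have posQ : posdefmx Q.
  apply/posdefmx_inv/posdefmxD => //.
  have [/symmetricmxP symF psdF] :=
    possemidefmx_congr H (posdefmx_possemidef posM).
  split=> [|x]; first by apply/symmetricmxP; rewrite linearZ /= symF.
  by rewrite -scalemxAr -scalemxAl mxE mulr_ge0.
have := gram_mul_eq0 (B *m H) X posQ; have := gram_mul_eq0 (B *m H) X (posdefmx1 R Nt).
by rewrite mulmx1 trmx_mul !mulmxA => -> ->.
Qed.

(** Taking for [X] the cokernel of either matrix shows that each row space contains the other. *)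
Lemma mxrank_same_ker n1 n2 m (A : 'M[R]_(n1, m)) (C : 'M[R]_(n2, m)) :
  (forall p (X : 'M[R]_(m, p)), A *m X = 0 <-> C *m X = 0) -> \rank A = \rank C.
Proof.
move=> same_ker; apply/eqP; rewrite eqn_leq !mxrankS // submxE; apply/eqP.
  exact/same_ker/mulmx_coker.
exact/same_ker/mulmx_coker.
Qed.

(** The nonzero diagonal entries form a prefix of some length [r]. Then [L] and [pid_mx r] are left
    multiples of each other up to a diagonal factor, so their kernels agree, and this in turn
    identifies [r] as the rank. *)
Lemma sorted_diag_ker n (L : 'M[R]_n) m (X : 'M[R]_(n, m)) :
  is_diag_mx L -> (forall i, 0 <= L i i) ->
  (forall i j : 'I_n, (i <= j)%N -> L j j <= L i i) ->
  (L *m X = 0) <-> ((pid_mx (\rank L) : 'M_n) *m X = 0).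
Proof.
move=> /is_diag_mxP diagL L_ge0 L_dec.
(* The position of the first zero on the diagonal, or [n] if there is none. *)
pose r := find (fun i : 'I_n => L i i == 0) (enum 'I_n).
have r_le : (r <= n)%N by rewrite -[leqRHS](size_enum_ord n) find_size.
have L_neq0 (i : 'I_n) : (L i i != 0) = (i < r)%N.
  case: ltnP => [i_r|r_i].
    by have := before_find i i_r; rewrite nth_ord_enum => ->.
  have hasL : has (fun i : 'I_n => L i i == 0) (enum 'I_n).
    by rewrite has_find size_enum_ord (leq_ltn_trans r_i).
  have /eqP Lr := nth_find i hasL.
  apply/negbTE; rewrite negbK eq_le L_ge0 andbT -Lr; apply: L_dec.
  by rewrite nth_enum_ord // (leq_ltn_trans r_i).
(* A pseudo-inverse of [L]: the inverse of a zero entry only ever meets that zero entry, so its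
   default value is harmless. *)
pose L' : 'M[R]_n := diag_mx (\row_i (L i i)^-1).
have eL : L = diag_mx (\row_i L i i).
  apply/matrixP=> i j; rewrite !mxE; have [<-|ij] := eqVneq i j.
    by rewrite mulr1n.
  by rewrite mulr0n diagL.
have e1 : L *m (pid_mx r : 'M_n) = L.
  rewrite {1}eL mul_diag_mx; apply/matrixP=> i j; rewrite !mxE.
  have [eij|nij] := eqVneq (i : nat) j; last by rewrite /= mulr0 diagL.
  have <- : i = j by apply: val_inj.
  by rewrite -L_neq0 /=; case: eqP => [->|_]; rewrite ?mulr1 ?mul0r.
have e2 : L' *m L = pid_mx r.
  rewrite mul_diag_mx; apply/matrixP=> i j; rewrite !mxE.
  have [eij|nij] := eqVneq (i : nat) j; last by rewrite /= (diagL i j) ?mulr0.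
  have <- : i = j by apply: val_inj.
  by rewrite -L_neq0 /=; case: eqP => [->|/eqP ?]; rewrite ?mulr0 ?mulVf.
have same_ker p (Y : 'M[R]_(n, p)) : L *m Y = 0 <-> (pid_mx r : 'M_n) *m Y = 0.
  split=> Y0; first by rewrite -e2 -mulmxA Y0 mulmx0.
  by rewrite -e1 -mulmxA Y0 mulmx0.
by rewrite (mxrank_same_ker same_ker) rank_pid_mx.
Qed.

(** This turns both cone conditions into conditions on the first rows in the coordinates of [V]. A
    matrix [X] covers vectors and whole products alike. *)
Lemma control_mul_eq0 (S Nr Nt : nat) (B : 'M[R]_(S, Nr)) (M : 'M[R]_Nr)
    (N : 'M[R]_Nt) (delta : R) (H : 'M[R]_(Nr, Nt)) (V Lambda : 'M[R]_S)
    m (X : 'M[R]_(S, m)) :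
  posdefmx M -> posdefmx N -> 0 <= delta ->
  symmetric_svd (gain_mx B M N delta H) V Lambda ->
  let K := control_mx B delta H in
  (K *m X = 0) <-> ((pid_mx (\rank K) : 'M_S) *m (V *m X) = 0).
Proof.
move=> posM posN delta_ge0 [VVt diagL L_ge0 L_dec eG] /=.
set K := control_mx B delta H.
have VtV := mulmx1C VVt.
have kerK p (Y : 'M[R]_(S, p)) : K *m Y = 0 <-> Lambda *m (V *m Y) = 0.
  rewrite (control_gain_ker B H Y posM posN delta_ge0) eG -!mulmxA.
  split=> [VY0|->]; last by rewrite mulmx0.
  by rewrite -[LHS]mul1mx -VVt -mulmxA VY0 mulmx0.
(* [K] and [Lambda *m V] have the same kernel, hence the same rank, and the invertible [V] does not
   change the rank of [Lambda]. *)
have -> : \rank K = \rank Lambda.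
  have <- : \rank (Lambda *m V) = \rank Lambda.
    by apply/mxrankMfree; rewrite row_free_unit; case/mulmx1_unit: VVt.
  by apply: mxrank_same_ker => p Y; rewrite kerK mulmxA.
by rewrite kerK; apply: sorted_diag_ker.
Qed.

End Kernels.

(** * Block splitting and the Schur complement *)

Section BlockSplitting.
Variables (R : realType) (g h : nat).

Lemma posdefmx_ulsubmx (W : 'M[R]_(g + h)) :
  posdefmx W -> posdefmx (ulsubmx W).
Proof.
move=> posW; have -> : ulsubmx W = (col_mx 1%:M 0)^T *m W *m col_mx 1%:M 0.
  rewrite -{2}(submxK W) tr_col_mx trmx1 trmx0 mul_row_block mul_row_col.
  by rewrite !mul0mx !addr0 !mul1mx mulmx1 mulmx0 addr0.
apply: posdefmx_congr => // x.
by rewrite mul_col_mx mul1mx mul0mx -col_mx0 => /eq_col_mx[].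
Qed.

(** Congruence by the block column with entries [- (invmx A *m C)] and [1]: the upper block of the
    product vanishes and the Schur complement is left. *)
Lemma possemidefmx_schur (A : 'M[R]_g) (C : 'M[R]_(g, h)) (D : 'M[R]_h) :
  A \in unitmx -> possemidefmx (block_mx A C C^T D) ->
  possemidefmx (D - C^T *m (invmx A *m C)).
Proof.
move=> uA psdW.
have := possemidefmx_congr (col_mx (- (invmx A *m C)) 1%:M) psdW.
rewrite -mulmxA mul_block_col tr_col_mx mul_row_col mulmxN mulmx1 mulKVmx //.
by rewrite addNr mulmx0 add0r trmx1 mul1mx mulmx1 mulmxN addrC.
Qed.

End BlockSplitting.

(** The block computation for an arbitrary split [e]; the control matrix enters only later, when
    [pid_mx g] is traded for it. *)
Lemma decomposition_blocks (R : realType) (g h n : nat) (e : (g + h = n)%N)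
    (V P : 'M[R]_n) :
  posdefmx P -> V *m V^T = 1%:M ->
  let Pc := controllable_part e V P in
  let Puc := uncontrollable_part e V P in
  [/\ P = Pc + Puc,
      possemidefmx Pc,
      possemidefmx Puc,
      (pid_mx g : 'M_n) *m (V *m Puc) = 0
    & forall x : 'cV_n,
        (pid_mx g : 'M_n) *m (V *m (Pc *m x)) = 0 -> Pc *m x = 0].
Proof.
move=> posP VVt /=; have VtV := mulmx1C VVt.
rewrite /controllable_part /uncontrollable_part /sigma_mx
  /leading_block /upper_right_block /assemble.
have posW : posdefmx (V *m P *m V^T).
  rewrite -{1}[V]trmxK; apply: posdefmx_congr => // x Vx0.
  by rewrite -[x]mul1mx -VVt -mulmxA Vx0 mulmx0.
have eP : P = V^T *m (V *m P *m V^T) *m V.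
  by rewrite !mulmxA VtV mul1mx -mulmxA VtV mulmx1.
have -> : V^T *m (1%:M - pid_mx g) *m V *m P *m V^T *m (1%:M - pid_mx g) *m V
    = V^T *m ((1%:M - pid_mx g) *m (V *m P *m V^T) *m (1%:M - pid_mx g)) *m V.
  by rewrite !mulmxA.
rewrite {1}eP; move: (V *m P *m V^T) posW => W posW {P posP eP}.
(* With [P] absorbed into [W], the size [n] can be replaced by [g + h], and all casts become
   trivial. *)
case: n / e V W VVt VtV posW => {}V W {}VVt VtV posW; rewrite !castmx_id.
have uA := posdefmx_unit (posdefmx_ulsubmx posW).
have psdA := posdefmx_possemidef (posdefmx_ulsubmx posW).
have eW : W = block_mx (ulsubmx W) (ursubmx W) (ursubmx W)^T (drsubmx W).
  case: posW => /symmetricmxP symW _.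
  by rewrite trmx_ursub symW submxK.
have [/symmetricmxP symA _] := psdA.
move: (ulsubmx W) (ursubmx W) (drsubmx W) eW uA psdA symA => A C D eW uA psdA symA.
have psdD : possemidefmx (D - C^T *m (invmx A *m C)).
  by apply: possemidefmx_schur => //; rewrite -eW; apply: posdefmx_possemidef.
rewrite !mulKVmx //.
have eSA : (invmx A *m C)^T *m A = C^T by rewrite trmx_mul trmx_inv symA mulmxKV.
rewrite !eSA.
have eU : (1%:M - pid_mx g) *m W *m (1%:M - pid_mx g) = block_mx 0 0 0 D.
  rewrite eW pid_mx_block (scalar_mx_block g h) opp_block_mx add_block_mx.
  rewrite subrr !subr0 !mulmx_block.
  by rewrite ?(mul0mx, mulmx0, add0r, addr0, mul1mx, mulmx1).
(* The subtracted corner block turns [D] into the Schur complement [E]. *)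
rewrite eU -mulmxBl -mulmxBr opp_block_mx add_block_mx !subr0.
set E := D - _.
have eE : V *m (V^T *m block_mx 0 0 0 E *m V) = block_mx 0 0 0 E *m V.
  by rewrite !mulmxA VVt mul1mx.
split.
- by rewrite -mulmxDl -mulmxDr add_block_mx !addr0 /E addrCA subrr addr0 -eW.
- have -> : block_mx A C C^T (C^T *m (invmx A *m C)) =
      (row_mx 1%:M (invmx A *m C))^T *m A *m row_mx 1%:M (invmx A *m C).
    rewrite tr_row_mx mul_col_mx mul_col_row trmx1 !mul1mx !mulmx1 eSA.
    by rewrite mulKVmx.
  by do 2!apply: possemidefmx_congr.
- apply: possemidefmx_congr.
  pose F : 'M[R]_(h, g + h) := row_mx 0 1%:M.
  have -> : block_mx 0 0 0 E = F^T *m E *m F.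
    rewrite /F tr_row_mx mul_col_mx mul_col_row trmx1 trmx0.
    by rewrite !mul0mx !mulmx0 mul1mx mulmx1.
  exact: possemidefmx_congr.
- rewrite eE pid_mx_block mulmxA mulmx_block !mul0mx !mulmx0 !addr0.
  by rewrite block_mx0 mul0mx.
(* The lower rows of the block matrix are [C^T *m invmx A] times the upper ones, so they vanish as
   soon as the upper ones do. *)
- move=> x; rewrite -!mulmxA (mulmxA V) VVt mul1mx.
  rewrite -(vsubmxK (V *m x)) mul_block_col pid_mx_block mul_block_col.
  rewrite !mul0mx mul1mx !addr0 -col_mx0 => /eq_col_mx[y0 _].
  have -> : C^T *m usubmx (V *m x) + C^T *m (invmx A *m C) *m dsubmx (V *m x)
     = C^T *m invmx A *m (A *m usubmx (V *m x) + C *m dsubmx (V *m x)).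
    by rewrite mulmxDr !mulmxA mulmxKV.
  by rewrite y0 mulmx0 col_mx0 mulmx0.
Qed.

Theorem theorem4 (R : realType) (S Nr Nt : nat)
    (B : 'M[R]_(S, Nr)) (M : 'M[R]_Nr) (N : 'M[R]_Nt)
    (hM : posdefmx M) (hN : posdefmx N)
    (P : 'M[R]_S) (hP : posdefmx P)
    (delta : R) (hdelta : delta = 0 \/ delta = 1)
    (H : 'M[R]_(Nr, Nt))
    (V Lambda : 'M[R]_S)
    (hsvd : symmetric_svd (gain_mx B M N delta H) V Lambda) :
  let K := control_mx B delta H in
  let Pc := controllable_part (rank_split K) V P in
  let Puc := uncontrollable_part (rank_split K) V P in
  [/\ P = Pc + Puc,
      controllable_cone K Pc
    & uncontrollable_cone K Puc].
Proof.
move=> K Pc Puc.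
have delta_ge0 : 0 <= delta by case: hdelta => ->; rewrite ?ler01.
have kerK m (X : 'M[R]_(S, m)) := control_mul_eq0 X hM hN delta_ge0 hsvd.
have VVt : V *m V^T = 1%:M by case: hsvd.
have [eP psdPc psdPuc uc0 c_ker] := decomposition_blocks (rank_split K) hP VVt.
split=> //; split=> //; last exact/kerK.
(* The substantial inclusion is that [K] kills no nonzero vector in the range of [Pc]. *)
apply/seteqP; split=> x; rewrite /colker /= -mulmxA; last by move=> ->; rewrite mulmx0.
by move/kerK/c_ker.
Qed.
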